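(* Let $T\ge0$ be such that all feasible solutions $X$ of Problem (P) satisfy $\mathrm{tr}(X)\le T$, and let the constraint $\mathrm{tr}(X)\le T$ be imposed in Problem (LO). Then every feasible solution $X$ of Problem (LO) satisfies $\|X\|_F\le nT$. Consequently, the set $\mathcal{X}$ of feasible solutions of Problem (LO) has diameter $D(\mathcal{X})\le 2nT$.
   Context: $S^n$ is the space of real symmetric $n\times n$ matrices, $\langle\cdot,\cdot\rangle$ the Euclidean (trace) inner product, $\|\cdot\|_F$ the Frobenius norm, $[n]=\{1,\dots,n\}$. The diameter of a set of matrices is $D(\mathcal{X})=\sup_{X,Y\in\mathcal{X}}\|X-Y\|_F$. Let $C,A_1,\dots,A_m\in S^n$ and $b\in\mathbb{R}^m$. Problem (P): $\min_{X\in S^n}\langle C,X\rangle$ s.t. $\langle A_i,X\rangle=b_i$ for all $i\in[m]$, $X\succeq0$. Problem (LO): $\min_{X\in S^n}\langle C,X\rangle$ s.t. $\langle A_i,X\rangle=b_i$ for all $i\in[m]$; $X_{i,i}\ge0$ for all $i\in[n]$; $X_{i,i}+X_{j,j}\pm2X_{i,j}\ge0$ for all $i,j\in[n]$ (both signs). *)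

(* Defs.v *)
From HB Require Import structures.
From mathcomp Require Import all_boot all_order all_algebra.
From mathcomp Require Import all_classical all_reals ereal.

Set Implicit Arguments.
Unset Strict Implicit.
Unset Printing Implicit Defensive.

Import Order.TTheory GRing.Theory Num.Theory.

Local Open Scope classical_set_scope.
Local Open Scope ring_scope.

Section MatrixGeometry.
Context {R : realType} {n : nat}.

Definition mxdot (X Y : 'M[R]_n) : R := \tr (X^T *m Y).

(* The norm `|X| that the analysis library puts on matrices is the maximum of
   the absolute values of the entries, not this one. *)
Definition frobenius_norm (X : 'M[R]_n) : R := Num.sqrt (mxdot X X).

(* The supremum is taken in \bar R, so that an unbounded set has diameter +oo
   (the real-valued sup would be 0); the empty set gets -oo. *)
Definition diameter (S : set 'M[R]_n) : \bar R :=
  ereal_sup [set (frobenius_norm (X - Y))%:E | X in S & Y in S].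

Definition possemidef (X : 'M[R]_n) : Prop :=
  X \is symmetricmx /\ forall v : 'cV[R]_n, 0 <= (v^T *m X *m v) 0 0.

End MatrixGeometry.

Record min_problem (R : realType) (E : Type) := MinProblem {
  objective : E -> R;
  feasible : set E
}.

Definition add_constraint (R : realType) (E : Type) (p : min_problem R E)
    (D : set E) : min_problem R E :=
  MinProblem (objective p) (feasible p `&` D).

Section Problems.
Context {R : realType} {n m : nat}.
Variables (C : 'M[R]_n) (A : 'I_m -> 'M[R]_n) (b : 'cV[R]_m).

Definition problem_P : min_problem R 'M[R]_n :=
  MinProblem (mxdot C)
    [set X | (forall i, mxdot (A i) X = b i 0) /\ possemidef X].

Definition problem_LO : min_problem R 'M[R]_n :=
  MinProblem (mxdot C)
    [set X | [/\ X \is symmetricmx,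
                 forall i, mxdot (A i) X = b i 0,
                 forall i, 0 <= X i i,
                 forall i j, 0 <= X i i + X j j + 2 * X i j
               & forall i j, 0 <= X i i + X j j - 2 * X i j]].

End Problems.

(* Main.v *)
Require Import Defs.
From HB Require Import structures.
From mathcomp Require Import all_boot all_order all_algebra.
From mathcomp Require Import all_classical all_reals ereal.
From mathcomp Require Import lra.

(** Every entry of a solution of the linear relaxation is dominated by the
    diagonal: the two inequalities on the signed sums say that |X i j| is at
    most the mean of X i i and X j j, and each diagonal entry, being one of
    the nonnegative summands of the trace, is at most T (lemma
    [normr_entry_le]).  A matrix of order n with entries bounded by c has
    Frobenius norm at most n c, since its n^2 squared entries sum to at most
    (n c)^2 (lemma [frobenius_norm_le]).  With c = T this bounds the norm of
    a solution.  The difference of two solutions has entries bounded by 2T, so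
    c = 2T bounds the diameter. *)

Set Implicit Arguments.
Unset Strict Implicit.
Unset Printing Implicit Defensive.

Import Order.TTheory GRing.Theory Num.Theory.

Local Open Scope classical_set_scope.
Local Open Scope ring_scope.

Lemma mxdotE (R : realType) (n : nat) (X Y : 'M[R]_n) :
  mxdot X Y = \sum_i \sum_j X i j * Y i j.
Proof.
rewrite exchange_big /=; apply: eq_bigr => j _; rewrite mxE.
by apply: eq_bigr => i _; rewrite mxE.
Qed.

Lemma frobenius_norm_le (R : realType) (n : nat) (X : 'M[R]_n) (c : R) :
  0 <= c -> (forall i j, `|X i j| <= c) -> frobenius_norm X <= n%:R * c.
Proof.
move=> c_ge0 Xc; have nc_ge0 : 0 <= n%:R * c by rewrite mulr_ge0.
rewrite -[leRHS]ger0_norm // -sqrtr_sqr; apply: ler_wsqrtr.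
have -> : (n%:R * c) ^+ 2 = \sum_(i < n) \sum_(j < n) c ^+ 2.
  by rewrite !sumr_const card_ord -mulrnA -[RHS]mulr_natl natrM exprMn expr2.
rewrite mxdotE; apply: ler_sum => i _; apply: ler_sum => j _.
by rewrite -expr2 -real_normK ?num_real // lerXn2r ?nnegrE.
Qed.

Lemma diag_le_mxtrace (R : realType) (n : nat) (X : 'M[R]_n) (i : 'I_n) :
  (forall k, 0 <= X k k) -> X i i <= \tr X.
Proof. by move=> X_ge0; rewrite /mxtrace (bigD1 i) //= lerDl sumr_ge0. Qed.

(** The sign inequalities bound |X i j| by the mean of two diagonal entries,
    which for i = j is X i i itself; bounding each of the two by the trace
    separately avoids distinguishing that case. *)
Lemma normr_entry_le (R : realType) (n : nat) (X : 'M[R]_n) (T : R) :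
    (forall i, 0 <= X i i) ->
    (forall i j, 0 <= X i i + X j j + 2 * X i j) ->
    (forall i j, 0 <= X i i + X j j - 2 * X i j) ->
    \tr X <= T ->
  forall i j, `|X i j| <= T.
Proof.
move=> X_ge0 Xp Xm trX i j.
have Xi := le_trans (diag_le_mxtrace i X_ge0) trX.
have Xj := le_trans (diag_le_mxtrace j X_ge0) trX.
by rewrite ler_norml; have := Xp i j; have := Xm i j; lra.
Qed.

Theorem mainTheorem3 (R : realType) (n m : nat)
    (C : 'M[R]_n) (A : 'I_m -> 'M[R]_n) (b : 'cV[R]_m) (T : R)
    (C_sym : C \is symmetricmx) (A_sym : forall i, A i \is symmetricmx)
    (T_ge0 : 0 <= T)
    (P_trace : forall X, feasible (problem_P C A b) X -> \tr X <= T) :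
  let LO := add_constraint (problem_LO C A b) [set X | \tr X <= T] in
  (forall X, feasible LO X -> frobenius_norm X <= n%:R * T) /\
  (diameter (feasible LO) <= (2 * n%:R * T)%:E)%E.
Proof.
move=> LO.
have LO_entry X : feasible LO X -> forall i j, `|X i j| <= T.
  by case=> -[_ _ X_ge0 Xp Xm] trX; apply: normr_entry_le.
split=> [X /LO_entry|]; first exact: frobenius_norm_le.
apply: ge_ereal_sup => _ [X /LO_entry XT [Y /LO_entry YT <-]].
rewrite lee_fin -mulrA mulrCA; apply: frobenius_norm_le => [|i j].
  by rewrite mulr_ge0.
rewrite !mxE (le_trans (ler_normB _ _)) //.
by have := XT i j; have := YT i j; lra.
Qed.
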